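(* Let $a>0$. For $P\in H^1_0(0,\pi)$ put $b_n=\frac2\pi\int_0^\pi P(\xi)\sin(n\xi)\,d\xi$, $n\ge1$. The problem $$-P''(x)+\sum_{n=1}^\infty n\coth(na)\,b_n\sin(nx)=\sin(2x)\ \text{ in }(0,\pi),\qquad P(0)=P(\pi)=0,$$ has the unique solution $$P(x)=P_a(x)=\frac{\sin(2x)}{2\,[2+\coth(2a)]},$$ and the corresponding non-porous problem $-P_0''(x)=\sin(2x)$ in $(0,\pi)$, $P_0(0)=P_0(\pi)=0$, has the solution $P_0(x)=\frac{\sin(2x)}4$. Consequently: (i) $|P_0(x)|>|P_a(x)|$ for every $x\in[0,\pi]$ with $\sin(2x)\neq0$; (ii) under the half-Sommerfeld condition (replacing $P_a$ and $P_0$ by their positive parts $P_a^+=\max(P_a,0)$ and $P_0^+=\max(P_0,0)$), one has $P_a^+(x)=\frac{\sin(2x)}{2[2+\coth(2a)]}$ for $0\le x\le\frac\pi2$ and $P_a^+(x)=0$ for $\frac\pi2<x\le\pi$, and the porous pressure is less than the non-porous one: $P_a^+(x)<P_0^+(x)$ for $0<x<\frac\pi2$; (iii) the pressure increases with the size $a$ of the porous matrix: for each $x\in(0,\frac\pi2)$ the map $a\mapsto P_a^+(x)$ is strictly increasing on $(0,\infty)$.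
   Context: This is the simplified model of the infinitely long bearing of small eccentricity ratio; $a$ is the thickness of the porous matrix $\{0<x<\pi,\ 0<y<a\}$. Solutions are sought in $H^1_0(0,\pi)$; for $P\in H^1_0(0,\pi)$ the series converges in $L^2(0,\pi)$ and the equation is understood in the sense of distributions on $(0,\pi)$. *)

(* Defs.v *)
From HB Require Import structures.
From mathcomp Require Import all_boot all_order all_algebra.
From mathcomp Require Import all_classical all_reals all_analysis.

Set Implicit Arguments.
Unset Strict Implicit.
Unset Printing Implicit Defensive.

Import Order.TTheory GRing.Theory Num.Theory.
Import numFieldNormedType.Exports.

Local Open Scope classical_set_scope.
Local Open Scope ring_scope.

Section Definitions.
Context {R : realType}.
Implicit Types (P S f u v phi : R -> R) (a x : R).

Local Notation mu := (@lebesgue_measure R).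
Local Notation D := (`]0%R, pi%R[%classic : set R).

Definition coth x : R := (expR x + expR (- x)) / (expR x - expR (- x)).

(* Functions on (0, pi) are represented by total functions R -> R whose values
   outside D are irrelevant; [f \_ D] is the extension of f|_D by 0. *)
Definition L2 f : Prop := f \_ D \in Lfun mu 2%:E.

Definition L2norm f : \bar R := 'N[mu]_(2%:E)[EFin \o (f \_ D)].

Definition L2cvg (u : nat -> R -> R) v : Prop :=
  L2norm (u k \- v) @[k --> \oo] --> 0%E.

(* C_c^oo(0, pi) *)
Definition test_function phi : Prop :=
  (forall (n : nat) x, derivable (derive1n n phi) x 1) /\
  exists K : set R,
    [/\ compact K, K `<=` D & forall x, ~ K x -> phi x = 0].

(* H^1_0(0, pi) is the closure of C_c^oo(0, pi) in H^1(0, pi); g is then the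
   weak derivative of P. For Borel P membership depends only on P modulo
   equality a.e. on (0, pi), and the boundary conditions P(0) = P(pi) = 0 are
   understood as membership in this space. *)
Definition H10 P : Prop :=
  L2 P /\ exists2 g : R -> R, L2 g &
    exists phi : nat -> R -> R,
      [/\ forall k, test_function (phi k),
          L2cvg phi P & L2cvg (fun k => derive1 (phi k)) g].

Definition sine_coef P (n : nat) : R :=
  2 / pi * \int[mu]_(xi in D) (P xi * sin (n%:R * xi)).

Definition porous_sum a P (N : nat) x : R :=
  \sum_(1 <= n < N.+1)
    n%:R * coth (n%:R * a) * sine_coef P n * sin (n%:R * x).

(* the distribution on (0, pi) defined by f, and its second derivative *)
Definition distr f phi : R := \int[mu]_(x in D) (f x * phi x).
Definition distr'' f phi : R := distr f (derive1n 2 phi).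

(* S is the L^2-sum of the series. *)
Definition porous_problem a P : Prop :=
  H10 P /\ exists S, [/\ L2 S, L2cvg (porous_sum a P) S &
    forall phi, test_function phi ->
      - distr'' P phi + distr S phi = distr (fun x => sin (2 * x)) phi].

Definition nonporous_problem P : Prop :=
  H10 P /\ forall phi, test_function phi ->
    - distr'' P phi = distr (fun x => sin (2 * x)) phi.

Definition P_porous a x : R := sin (2 * x) / (2 * (2 + coth (2 * a))).

Definition P_nonporous x : R := sin (2 * x) / 4.

End Definitions.

(* Main.v *)
Require Import Defs.
From HB Require Import structures.
From mathcomp Require Import all_boot all_order all_algebra.
From mathcomp Require Import all_classical all_reals all_analysis.
From mathcomp Require Import measurable_realfun.
From mathcomp Require Import ring lra.

(* Existence: sin(2x) diagonalises both -d^2/dx^2 and the Fourier multiplier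
   n coth(na). Membership of sin(2x) in H^1_0 is obtained by multiplying it with
   the smooth cutoffs exp(-1/t), t = (k+1) x (pi - x) - 1, whose gradient is
   compensated by |sin(2x)| <= 2 x (pi - x).
   Uniqueness is an energy argument: the difference W of two solutions satisfies
   |W'|^2 + sum_n (pi/2) n coth(na) b_n^2 = 0, so W' = 0 and W = 0 by the
   Poincare inequality; no completeness of the sine system is needed.
   The comparison statements follow from coth > 1 and its strict decrease on
   (0, +oo). *)

Import Order.TTheory GRing.Theory Num.Theory.
Import numFieldNormedType.Exports.

Local Open Scope classical_set_scope.
Local Open Scope ring_scope.

(** * The space L^2(0, pi) *)

Section L2_theory.
Set Implicit Arguments.
Unset Strict Implicit.
Context {R : realType}.
Implicit Types (f g h u v : R -> R) (c : R).

Local Notation mu := (@lebesgue_measure R).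
Local Notation D := (`]0%R, pi[%classic : set R).

(** The equation may be tested only with compactly supported smooth functions, whereas the energy
    argument needs W itself. It is therefore written for each member u_k of the sequence that [H10]
    provides for W, and only L^2 pairings are passed to the limit. The weak derivative g thus
    appears solely as the L^2 limit of u_k', Poincare is needed for test functions alone, and the
    series enters only through the pairing of S with W, a limit of nonnegative finite sums. The
    bilinear [distr] serves throughout as the L^2 inner product. For membership in H^1_0 the
    obstacle is that the gradient of the cutoff carries a factor k+1. Since (k+1) x (pi - x) is
    exactly t + 1, the bound on |sin(2x)| turns this factor into t + 1, and t e^{-1/t} t^{-2} =
    e^{-1/t} t^{-1} is still bounded and tends to 0 as t grows. *)

Lemma measurable_D : measurable D.
Proof. exact: measurable_itv. Qed.

(** Replaces the zero extension by two conditions on D itself, from which the closure properties of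
    L^2 are derived. *)
Lemma L2P f : L2 f <->
  measurable_fun D f /\ mu.-integrable D (EFin \o (fun x => f x ^+ 2)).
Proof.
have sqrD : EFin \o (fun x => (f \_ D) x ^+ 2)
            = (EFin \o (fun x => f x ^+ 2)) \_ D.
  rewrite restrict_EFin; apply/funext => x /=.
  by rewrite /patch; case: ifP => // _; rewrite expr0n.
split=> [Lf|[mf if2]].
  have mf : measurable_fun setT (f \_ D).
    by move: Lf; rewrite /L2 inE => /andP[]; rewrite inE.
  split; first exact/(measurable_restrictT _ measurable_D).
  apply: (iffRL (integrable_mkcond (mu := mu) _ measurable_D)); rewrite -sqrD.
  exact: (Lfun2_integrable_sqr (mu := mu) Lf).
rewrite /L2 inE; apply/andP; split.
  by rewrite inE; exact/(measurable_restrictT _ measurable_D).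
rewrite inE /= /finite_norm unlock poweR_lty//.
move: if2 => /(iffLR (integrable_mkcond (mu := mu) _ measurable_D)); rewrite -sqrD.
move=> /integrableP[_]; apply: le_lt_trans.
rewrite le_eqVlt; apply/orP; left; apply/eqP; apply: eq_integral => x _ /=.
by rewrite powR_mulrn// real_normK ?num_real// ger0_norm// sqr_ge0.
Qed.

Lemma L2_integrableM f g : L2 f -> L2 g ->
  mu.-integrable D (EFin \o (fun x => f x * g x)).
Proof.
move=> /L2P[mf f2] /L2P[mg g2].
have fg2 := integrableD (mu := mu) measurable_D f2 g2.
apply: (le_integrable (mu := mu) measurable_D _ _ fg2).
  by apply/measurable_EFinP; exact: measurable_funM.
move=> x _; rewrite /comp -EFinD !abse_EFin lee_fin [leRHS]ger0_norm ?addr_ge0 ?sqr_ge0// normrM.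
(* Expanding this square bounds |f g| by f^2 + g^2. *)
have := sqr_ge0 (`|f x| - `|g x|).
have : 0 <= `|f x| * `|g x| by rewrite mulr_ge0.
rewrite sqrrB !real_normK ?num_real//; lra.
Qed.

(** Continuity on the whole line makes f^2 integrable on the compact [0, pi], hence on D. *)
Lemma L2_continuous f : continuous f -> L2 f.
Proof.
move=> cf; apply/L2P; split.
  apply: (measurable_funS measurableT) => //.
  exact: measurable_realfun.continuous_measurable_fun.
apply: (@integrableS _ _ _ mu `[0, pi]%classic) => //.
  exact: subset_itv_oo_cc.
apply: continuous_compact_integrable; first exact: segment_compact.
apply: continuous_subspaceT => x; under eq_fun do rewrite expr2.
by apply: continuousM; exact: cf.
Qed.

Lemma L2B f g : L2 f -> L2 g -> L2 (f \- g).
Proof.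
move=> Lf Lg; move: (Lf) (Lg) => /L2P[mf f2] /L2P[mg g2].
apply/L2P; split; first exact: measurable_funB.
have := integrableB (mu := mu) measurable_D (integrableD (mu := mu) measurable_D f2 g2)
  (integrableZl (mu := mu) measurable_D 2 (L2_integrableM Lf Lg)).
apply: eq_integrable => //.
move=> x _; apply: (@congr1 _ _ EFin (f x ^+ 2 + g x ^+ 2 - 2 * (f x * g x))).
by rewrite /=; ring.
Qed.

Lemma L2Z c f : L2 f -> L2 (fun x => c * f x).
Proof.
move=> /L2P[mf f2]; apply/L2P; split; first exact: measurable_funM.
have := integrableZl (mu := mu) measurable_D (c ^+ 2) f2.
apply: eq_integrable => //.
by move=> x _ /=; rewrite -EFinM exprMn.
Qed.

Lemma distr_sym f g : distr f g = distr g f.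
Proof. by apply: eq_Rintegral => x _; rewrite mulrC. Qed.

Lemma distrBl f g h : L2 f -> L2 g -> L2 h ->
  distr (f \- g) h = distr f h - distr g h.
Proof.
move=> Lf Lg Lh; rewrite /distr -RintegralB//; last 2 first.
- exact: L2_integrableM.
- exact: L2_integrableM.
by apply: eq_Rintegral => x _ /=; rewrite mulrBl.
Qed.

Lemma distrBr f g h : L2 f -> L2 g -> L2 h ->
  distr h (f \- g) = distr h f - distr h g.
Proof. by move=> Lf Lg Lh; rewrite distr_sym distrBl// ![distr _ h]distr_sym. Qed.

Lemma distrZl c f h : L2 f -> L2 h ->
  distr (fun x => c * f x) h = c * distr f h.
Proof.
move=> Lf Lh; rewrite /distr -RintegralZl//; last exact: L2_integrableM.
by apply: eq_Rintegral => x _ /=; rewrite mulrA.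
Qed.

Lemma distrZr c f h : L2 f -> L2 h ->
  distr h (fun x => c * f x) = c * distr h f.
Proof. by move=> Lf Lh; rewrite distr_sym distrZl// distr_sym. Qed.

Lemma distr_ge0 f : 0 <= distr f f.
Proof. by apply: Rintegral_ge0 => x _; rewrite -expr2 sqr_ge0. Qed.

Lemma distr_CauchySchwarz f g : L2 f -> L2 g ->
  distr f g ^+ 2 <= distr f f * distr g g.
Proof.
move=> Lf Lg.
(* The squared norm of s f - t g, as a quadratic form in (s, t). *)
have Q s t : 0 <= s ^+ 2 * distr f f - 2 * s * t * distr f g
                  + t ^+ 2 * distr g g.
  have := distr_ge0 ((fun x => s * f x) \- (fun x => t * g x)).
  have Lsf := L2Z s Lf; have Ltg := L2Z t Lg.
  rewrite distrBl ?distrBr//; last exact: L2B.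
  rewrite !distrZl ?distrZr// [distr g f]distr_sym.
  by congr (0 <= _); ring.
(* With A, B, C the three pairings set below, (s, t) = (C, B) and (B, A) give C (A C - B^2) >= 0 and
   A (A C - B^2) >= 0. If A = C = 0, the pair (B, 1) leaves -2 B^2 >= 0. *)
have := Q (distr g g) (distr f g); have := Q (distr f g) (distr f f).
have := Q 1 (distr f g); have := Q (distr f g) 1.
have := distr_ge0 f; have := distr_ge0 g.
set A := distr f f; set C := distr g g; set B := distr f g => C0 A0 H1 H2 H3 H4.
have [A_eq0|A_neq0] := eqVneq A 0; last first.
  have Ap : 0 < A by rewrite lt_def A_neq0.
  rewrite -(ler_pM2l Ap); nra.
have [C_eq0|C_neq0] := eqVneq C 0; last first.
  have Cp : 0 < C by rewrite lt_def C_neq0.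
  rewrite -(ler_pM2l Cp); nra.
move: H1; rewrite A_eq0 C_eq0; nra.
Qed.

Lemma L2normE f : L2 f -> L2norm f = (Num.sqrt (distr f f))%:E.
Proof.
move=> Lf; move: (Lf) => /L2P[mf f2].
rewrite /L2norm unlock.
have -> : (\int[mu]_x (`|(EFin \o f \_ D) x| `^ 2) = (distr f f)%:E)%E.
  rewrite /distr /Rintegral fineK; last first.
    apply: integrable_fin_num; first exact: measurable_D.
    exact: L2_integrableM.
  rewrite [RHS]integral_mkcond; apply: eq_integral => x _ /=.
  rewrite powR_mulrn// real_normK ?num_real// /patch.
  by case: ifP => // _; rewrite expr0n.
by rewrite poweR_EFin powR12_sqrt// distr_ge0.
Qed.

(** Squaring the norm removes the root and the extended reals, so convergence can be handled by
    bilinear algebra. *)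
Lemma L2cvgE (u : nat -> R -> R) v : (forall k, L2 (u k)) -> L2 v ->
  L2cvg u v <-> distr (u k \- v) (u k \- v) @[k --> \oo] --> 0.
Proof.
move=> Lu Lv; rewrite /L2cvg.
have -> : (fun k => L2norm (u k \- v))
    = (fun k => (Num.sqrt (distr (u k \- v) (u k \- v)))%:E).
  by apply/funext => k; rewrite L2normE//; exact: L2B.
split=> [/fine_cvgP[_ /= H]|H].
  rewrite -(mulr0 0).
  have -> : (fun k => distr (u k \- v) (u k \- v)) =
      (fun k => Num.sqrt (distr (u k \- v) (u k \- v))) \*
      (fun k => Num.sqrt (distr (u k \- v) (u k \- v))).
    by apply/funext => k; rewrite /= -expr2 sqr_sqrtr// distr_ge0.
  exact: cvgM.
apply: cvg_EFin; first exact: nearW.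
have := cvg_comp _ _ H (@sqrt_continuous R 0).
by rewrite sqrtr0.
Unshelve. all: by end_near. Qed.

(** Strong convergence implies weak convergence: Cauchy-Schwarz bounds the error by |u_k - v| |h| in
    L^2 norms. *)
Lemma L2cvg_distr (u : nat -> R -> R) v h : (forall k, L2 (u k)) -> L2 v ->
  L2 h -> L2cvg u v -> distr (u k) h @[k --> \oo] --> distr v h.
Proof.
move=> Lu Lv Lh /(L2cvgE Lu Lv) uv.
have H k : `|distr (u k) h - distr v h|
   <= Num.sqrt (distr (u k \- v) (u k \- v)) * Num.sqrt (distr h h).
  rewrite -distrBl// -sqrtrM ?distr_ge0// -sqrtr_sqr ler_wsqrtr//.
  by apply: distr_CauchySchwarz => //; exact: L2B.
apply/cvgrPdist_le => /= e e0.
have : Num.sqrt (distr (u k \- v) (u k \- v)) * Num.sqrt (distr h h)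
    @[k --> \oo] --> 0.
  have := cvg_comp _ _ uv (@sqrt_continuous R 0).
  rewrite sqrtr0 => H0; rewrite -(mul0r (Num.sqrt (distr h h))).
  by apply: cvgM; [exact: H0|exact: cvg_cst].
move=> /cvgrPdist_le/(_ e e0); apply: filterS => k.
rewrite sub0r normrN => /(le_trans _); apply.
by rewrite [leRHS]ger0_norm ?mulr_ge0 ?sqrtr_ge0// Num.Theory.distrC; exact: H.
Qed.

Lemma distr_eq0_ae f : L2 f -> distr f f = 0 -> ae_eq mu D f (cst 0).
Proof.
move=> Lf f0; move: (Lf) => /L2P[mf f2].
have : ae_eq mu D (EFin \o (fun x => f x ^+ 2)) (cst 0).
  apply/ae_eq_integral_abs; first exact: measurable_D.
  - by case/integrableP: f2.
  - transitivity ((distr f f)%:E); last by rewrite f0.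
    rewrite fineK; last first.
      by apply: integrable_fin_num => //; exact: L2_integrableM.
    by apply: eq_integral => x _ /=; rewrite ger0_norm ?sqr_ge0// expr2.
apply: filterS => x /= H Dx; apply/eqP; rewrite -sqrf_eq0; apply/eqP.
by have [] := H Dx.
Qed.

End L2_theory.

(** * Calculus and a class of smooth functions *)

Section real_calculus.
Set Implicit Arguments.
Unset Strict Implicit.
Context {R : realType}.
Implicit Types (f g h : R -> R) (x : R).

Local Notation mu := (@lebesgue_measure R).
Local Notation D := (`]0%R, pi[%classic : set R).

(** This and the next rules are in lambda form, so that the derivative of an explicit formula is
    assembled as one term and then adjusted by [is_derive_eq]. *)
Lemma is_derive1D f g x df dg : is_derive x 1 f df -> is_derive x 1 g dg ->
  is_derive x 1 (fun y => f y + g y) (df + dg).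
Proof. by move=> Hf Hg; have := is_deriveD Hf Hg. Qed.

Lemma is_derive1B f g x df dg : is_derive x 1 f df -> is_derive x 1 g dg ->
  is_derive x 1 (fun y => f y - g y) (df - dg).
Proof. by move=> Hf Hg; have := is_deriveB Hf Hg. Qed.

Lemma is_derive1M f g x df dg : is_derive x 1 f df -> is_derive x 1 g dg ->
  is_derive x 1 (fun y => f y * g y) (df * g x + f x * dg).
Proof.
move=> Hf Hg; have := is_deriveM Hf Hg; move/is_derive_eq; apply.
by rewrite addrC mulrC.
Qed.

Lemma is_derive1_cst (c : R) x : is_derive x 1 (fun _ : R => c) 0.
Proof. exact: is_derive_cst. Qed.

Lemma is_derive1_id x : is_derive x 1 (fun y : R => y) 1.
Proof. exact: is_derive_id. Qed.

Lemma is_derive1Z (c : R) f x df : is_derive x 1 f df ->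
  is_derive x 1 (fun y => c * f y) (c * df).
Proof.
move=> Hf; have := is_derive1M (is_derive1_cst c x) Hf.
by move/is_derive_eq; apply; rewrite mul0r add0r.
Qed.

Lemma is_derive_sinZ (c x : R) :
  is_derive x 1 (fun y => sin (c * y)) (c * cos (c * x)).
Proof.
have := is_derive1_comp (is_derive_sin (c * x)) (is_derive1Z c (is_derive1_id x)).
by move/is_derive_eq; apply; rewrite mulr1 mulrC.
Qed.

Lemma is_derive_cosZ (c x : R) :
  is_derive x 1 (fun y => cos (c * y)) (- (c * sin (c * x))).
Proof.
have := is_derive1_comp (is_derive_cos (c * x)) (is_derive1Z c (is_derive1_id x)).
by move/is_derive_eq; apply; rewrite mulr1 mulrC mulrN.
Qed.

Lemma is_derive_continuous f (f' : R -> R) :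
  (forall x, is_derive x 1 f (f' x)) -> continuous f.
Proof.
move=> H x; apply: differentiable_continuous; apply/derivable1_diffP.
by case: (H x).
Qed.

Lemma is_derive_derive1 f (f' : R -> R) :
  (forall x, is_derive x 1 f (f' x)) -> derive1 f = f'.
Proof.
by move=> H; apply/funext => x; rewrite derive1E; case: (H x).
Qed.

Lemma derivable_is_derive f x : derivable f x 1 -> is_derive x 1 f (derive1 f x).
Proof. by move=> /derivableP; rewrite derive1E. Qed.

Lemma continuous1D f g : continuous f -> continuous g ->
  continuous (fun x => f x + g x).
Proof. by move=> cf cg x; have := continuousD (cf x) (cg x). Qed.

Lemma continuous1M f g : continuous f -> continuous g ->
  continuous (fun x => f x * g x).
Proof. by move=> cf cg x; have := continuousM (cf x) (cg x). Qed.

Lemma integral_D_derive (F f : R -> R) : (forall x, is_derive x 1 F (f x)) ->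
  continuous f -> \int[mu]_(x in D) f x = F pi - F 0.
Proof.
move=> dF cf.
have cF := is_derive_continuous dF.
have ipi : mu.-integrable `[0, pi]%classic (EFin \o f).
  apply: continuous_compact_integrable; first exact: segment_compact.
  exact: continuous_subspaceT.
(* The endpoints are null, so the integral moves to [0, pi], where the fundamental theorem
   applies. *)
rewrite Rintegral_itv_obnd_cbnd; last first.
  by apply: integrableS ipi => //; exact: subset_itv_oo_cc.
rewrite Rintegral_itv_bndo_bndc; last first.
  by apply: integrableS ipi => //; exact: subset_itv_co_cc.
rewrite /Rintegral (continuous_FTC2 (F := F))//.
- exact: pi_gt0.
- exact: continuous_subspaceT.
- split.
  + by move=> x _; case: (dF x).
  + exact: (cvg_at_right_filter (cF _)).
  + exact: (cvg_at_left_filter (cF _)).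
- by move=> x _; rewrite (is_derive_derive1 dF).
Qed.

(* The functions e^{-1/t} t^{-m} on t > 0 extended by 0: smooth across 0, and
   their linear combinations are closed under differentiation. *)
Definition flat (m : nat) (t : R) : R :=
  if 0 < t then expR (- t^-1) * t^-1 ^+ m else 0.

Lemma flat_le0 m t : t <= 0 -> flat m t = 0.
Proof. by move=> t0; rewrite /flat ltNge t0. Qed.

Lemma flat_ge0 m t : 0 <= flat m t.
Proof.
rewrite /flat; case: ifP => // t0.
by rewrite mulr_ge0 ?expR_ge0// exprn_ge0// invr_ge0 ltW.
Qed.

(** With u = 1/t, the term u^m / m! of the exponential series is at most e^u. *)
Lemma flat_le_fact m t : flat m t <= m`!%:R.
Proof.
rewrite /flat; case: ifPn => // t0.
have u0 : 0 <= t^-1 by rewrite invr_ge0 ltW.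
rewrite expRN mulrC ler_pdivrMr ?expR_gt0//.
case: m => [|m]; first by rewrite expr0 fact0 mul1r -expR0 ler_expR.
have := expR_ge1Dxn m u0.
move=> /(le_trans _) H; rewrite -ler_pdivrMl ?ltr0n ?fact_gt0// mulrC.
by apply: H; rewrite lerDr.
Qed.

(** Combined with the uniform bound by a factorial, this gives both flatness at 0 and decay at
    infinity. *)
Lemma flatS m t : t * flat m.+1 t = flat m t.
Proof.
rewrite /flat; case: ifPn => [t0|_]; last by rewrite mulr0.
by rewrite exprS mulrCA; congr (_ * _); rewrite mulVKf ?gt_eqF.
Qed.

Lemma is_derive_flat0 (m : nat) : is_derive (0 : R) 1 (flat m) 0.
Proof.
(* Two powers of h are extracted from [flat m.+2 h]; the difference quotient at 0 is then O(h). *)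
have bnd (h : R) : `|flat m h| <= (m.+2)`!%:R * h ^+ 2.
  have [h0|h0] := leP h 0.
    by rewrite flat_le0// normr0 mulr_ge0 ?sqr_ge0.
  rewrite ger0_norm ?flat_ge0// -flatS -[X in _ * X]flatS mulrA -expr2 mulrC.
  by rewrite ler_wpM2r ?sqr_ge0// flat_le_fact.
have H : h^-1 *: (flat m (h *: 1 + 0) - flat m 0) @[h --> 0^'] --> 0.
  apply/cvgrPdist_le => /= e e0.
  have C0 : 0 < (m.+2)`!%:R :> R by rewrite ltr0n fact_gt0.
  near=> h.
  have hn0 : h != 0 by near: h; exact: nbhs_dnbhs_neq.
  rewrite sub0r normrN (flat_le0 _ (lexx 0)) subr0 addr0 /GRing.scale /= mulr1.
  rewrite normrM normfV ler_pdivrMl ?normr_gt0//.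
  rewrite (le_trans (bnd h))// -real_normK ?num_real// expr2 mulrA mulrC.
  rewrite ler_wpM2l// -ler_pdivlMl//.
  near: h; apply: dnbhs0_le; rewrite mulr_gt0// invr_gt0//.
apply: DeriveDef; first by apply/cvg_ex; exists 0.
exact: cvg_lim.
Unshelve. all: by end_near. Qed.

Lemma is_derive_flat (m : nat) (t : R) :
  is_derive t 1 (flat m) (flat m.+2 t - m%:R * flat m.+1 t).
Proof.
have [t0|t0|->] := ltgtP t 0.
- rewrite !flat_le0 ?ltW// mulr0 subr0.
  apply: near_eq_is_derive (is_derive1_cst 0 t).
  near=> s; rewrite flat_le0// ltW//; near: s.
  exact: lt_nbhsl.
- have tn0 : t != 0 by rewrite gt_eqF.
  have dV : is_derive t 1 (fun s : R => s^-1) (- t ^- 2).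
    have := is_deriveV tn0 (is_derive1_id t).
    by move/is_derive_eq; apply; rewrite /GRing.scale /= mulr1.
  have dN : is_derive t 1 (fun s : R => - s^-1) (- - t ^- 2) := is_deriveN dV.
  have dE := @is_derive1_comp _ expR (fun s : R => - s^-1) t _ _ (is_derive_expR (- t^-1)) dN.
  have dX : is_derive t 1 (fun s : R => s^-1 ^+ m)
      (m%:R * t^-1 ^+ m.-1 * - t ^- 2).
    by have := is_deriveX m dV; rewrite exprfctE.
  have H := is_derive1M dE dX.
  apply: near_eq_is_derive (is_derive_eq H _).
    by apply: filterS (lt_nbhsr t0) => s s0; rewrite /flat s0.
  rewrite /flat t0 /=.
  (* The power rule involves the truncated predecessor of m, so m = 0 is computed apart. *)
  case: m {H dX} => [|m] /=.
    by rewrite !mul0r mulr0 subr0 addr0 expr0 mulr1 exprVn opprK.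
  by rewrite -!exprVn !exprS; ring.
- by rewrite !flat_le0// mulr0 subr0; exact: is_derive_flat0.
Unshelve. all: by end_near. Qed.

(** A class closed under differentiation reduces smoothness of every order to an induction on n. All
    [flat m] are included because differentiation raises m. *)
Inductive elementary : (R -> R) -> Prop :=
| elementary_cst c : elementary (fun=> c)
| elementary_id : elementary (fun x => x)
| elementary_sin : elementary sin
| elementary_cos : elementary cos
| elementary_flat m : elementary (flat m)
| elementaryD f g : elementary f -> elementary g ->
    elementary (fun x => f x + g x)
| elementaryM f g : elementary f -> elementary g ->
    elementary (fun x => f x * g x)
| elementary_comp f g : elementary f -> elementary g ->
    elementary (fun x => f (g x)).

Lemma elementary_derive f : elementary f ->
  exists2 f', elementary f' & forall x, is_derive x 1 f (f' x).
Proof.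
elim=> {f} [c| | | |m|f g ef [f' ef' df] eg [g' eg' dg]
  |f g ef [f' ef' df] eg [g' eg' dg]|f g ef [f' ef' df] eg [g' eg' dg]].
- exists (fun=> 0); first exact: elementary_cst.
  by move=> x; exact: is_derive1_cst.
- exists (fun=> 1); first exact: elementary_cst.
  by move=> x; exact: is_derive1_id.
- exists cos; first exact: elementary_cos.
  by move=> x; exact: is_derive_sin.
- exists (fun x => (-1) * sin x).
    by apply: elementaryM; [exact: elementary_cst|exact: elementary_sin].
  by move=> x; rewrite mulN1r; exact: is_derive_cos.
- exists (fun t => flat m.+2 t + (- m%:R) * flat m.+1 t).
    apply: elementaryD; first exact: elementary_flat.
    by apply: elementaryM; [exact: elementary_cst|exact: elementary_flat].
  by move=> x; rewrite mulNr; exact: is_derive_flat.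
- exists (fun x => f' x + g' x); first exact: elementaryD.
  by move=> x; exact: is_derive1D.
- exists (fun x => f' x * g x + f x * g' x).
    by apply: elementaryD; exact: elementaryM.
  by move=> x; exact: is_derive1M.
- exists (fun x => f' (g x) * g' x).
    by apply: elementaryM => //; exact: elementary_comp.
  by move=> x; exact: is_derive1_comp.
Qed.

Lemma elementary_smooth f : elementary f ->
  forall (n : nat) x, derivable (derive1n n f) x 1.
Proof.
move=> ef n; suff : elementary (derive1n n f).
  by move=> /elementary_derive[f' _ df] x; case: (df x).
elim: n => [|n /elementary_derive[f' ef' df]]; first by rewrite derive1n0.
by rewrite derive1nS (is_derive_derive1 df).
Qed.

End real_calculus.

(** * Test functions and H^1_0(0, pi) *)

Section test_functions.
Set Implicit Arguments.
Unset Strict Implicit.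
Context {R : realType}.
Implicit Types (f g h phi psi P Q : R -> R) (x c : R).

Local Notation mu := (@lebesgue_measure R).
Local Notation D := (`]0%R, pi[%classic : set R).

Lemma test_is_derive phi x : test_function phi ->
  is_derive x 1 phi (derive1 phi x).
Proof. by move=> [/(_ 0%N) H _]; apply: derivable_is_derive. Qed.

Lemma test_is_derive2 phi x : test_function phi ->
  is_derive x 1 (derive1 phi) (derive1n 2 phi x).
Proof.
by move=> [/(_ 1%N) H _]; rewrite derive1nS; apply: derivable_is_derive.
Qed.

Lemma test_continuous phi : test_function phi -> continuous phi.
Proof. by move=> t; apply: is_derive_continuous => x; exact: test_is_derive. Qed.

Lemma test_continuous1 phi : test_function phi -> continuous (derive1 phi).
Proof. by move=> t; apply: is_derive_continuous => x; exact: test_is_derive2. Qed.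

Lemma test_continuous2 phi : test_function phi -> continuous (derive1n 2 phi).
Proof.
move=> [/(_ 2%N) H _]; apply: is_derive_continuous => x.
by apply: derivable_is_derive; exact: H.
Qed.

Lemma test_L2 phi : test_function phi -> L2 phi.
Proof. by move=> /test_continuous/L2_continuous. Qed.

Lemma test_L2_1 phi : test_function phi -> L2 (derive1 phi).
Proof. by move=> /test_continuous1/L2_continuous. Qed.

Lemma test_L2_2 phi : test_function phi -> L2 (derive1n 2 phi).
Proof. by move=> /test_continuous2/L2_continuous. Qed.

Lemma test_eq0 phi x : test_function phi -> ~ D x -> phi x = 0.
Proof. by move=> [_ [K [_ KD H]]] Dx; apply: H => /KD. Qed.

Lemma test_at0 phi : test_function phi -> phi 0 = 0.
Proof. by move/test_eq0; apply; rewrite /= in_itv /= ltxx. Qed.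

Lemma test_atpi phi : test_function phi -> phi pi = 0.
Proof. by move/test_eq0; apply; rewrite /= in_itv /= ltxx andbF. Qed.

Lemma test_functionB phi psi : test_function phi -> test_function psi ->
  test_function (phi \- psi).
Proof.
move=> [dphi [K [cK KD K0]]] [dpsi [L [cL LD L0]]].
have E n : derive1n n (phi \- psi) = derive1n n phi \- derive1n n psi.
  elim: n => [|n IH]; first by rewrite !derive1n0.
  rewrite !derive1nS IH; apply: is_derive_derive1 => x.
  by apply: is_derive1B; apply: derivable_is_derive.
split; first by move=> n x; rewrite E; apply: derivableB.
exists (K `|` L); split; first exact: compactU.
- by move=> x [/KD|/LD].
- by move=> x /not_orP[/K0 /= -> /L0 ->]; rewrite subr0.
Qed.

Lemma derive1_testB phi psi : test_function phi -> test_function psi ->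
  derive1 (phi \- psi) = derive1 phi \- derive1 psi.
Proof.
move=> tphi tpsi; apply: is_derive_derive1 => x.
by apply: is_derive1B; exact: test_is_derive.
Qed.

(** The boundary terms are assumed to vanish as products, so either factor may supply the zero: a
    test function, or sin(2x). *)
Lemma distr_by_parts (F G f g : R -> R) : (forall x, is_derive x 1 F (f x)) ->
  (forall x, is_derive x 1 G (g x)) -> continuous f -> continuous g ->
  F 0 * G 0 = 0 -> F pi * G pi = 0 -> distr F g = - distr f G.
Proof.
move=> dF dG cf cg e0 epi.
have cF := is_derive_continuous dF; have cG := is_derive_continuous dG.
have LF := L2_continuous cF; have LG := L2_continuous cG.
have Lf := L2_continuous cf; have Lg := L2_continuous cg.
apply/eqP; rewrite eq_sym -subr_eq0 -opprD oppr_eq0; apply/eqP.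
rewrite /distr -RintegralD//; last 2 first.
- exact: L2_integrableM.
- exact: L2_integrableM.
have dFG x : is_derive x 1 (fun x => F x * G x) (f x * G x + F x * g x).
  exact: is_derive1M.
have cFG : continuous (fun x => f x * G x + F x * g x).
  by apply: continuous1D; exact: continuous1M.
by have := integral_D_derive dFG cFG; rewrite e0 epi subr0.
Qed.

Lemma distr_subr_le f g : L2 f -> L2 g ->
  distr (f \- g) (f \- g) <= 2 * distr f f + 2 * distr g g.
Proof.
move=> Lf Lg; have Lm : L2 (fun x => (-1) * g x) by exact: L2Z.
(* This is |f + g|^2 >= 0; since |f - g|^2 + |f + g|^2 = 2 |f|^2 + 2 |g|^2, the bound follows. *)
have := distr_ge0 (f \- (fun x => (-1) * g x)).
rewrite !distrBl ?distrBr//; [|exact: L2B|exact: L2B].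
rewrite !distrZl ?distrZr//; rewrite [distr g f]distr_sym; lra.
Qed.

Lemma L2cvgB (u v : nat -> R -> R) P Q : (forall k, L2 (u k)) ->
  (forall k, L2 (v k)) -> L2 P -> L2 Q -> L2cvg u P -> L2cvg v Q ->
  L2cvg (fun k => u k \- v k) (P \- Q).
Proof.
move=> Lu Lv LP LQ /(L2cvgE Lu LP) uP /(L2cvgE Lv LQ) vQ.
apply/L2cvgE; [by move=> k; exact: L2B|exact: L2B|].
have H k : distr ((u k \- v k) \- (P \- Q)) ((u k \- v k) \- (P \- Q)) <=
    2 * distr (u k \- P) (u k \- P) + 2 * distr (v k \- Q) (v k \- Q).
  have LuP : L2 (u k \- P) by exact: L2B.
  have LvQ : L2 (v k \- Q) by exact: L2B.
  have -> : (u k \- v k) \- (P \- Q) = (u k \- P) \- (v k \- Q).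
    by apply/funext => x /=; ring.
  exact: distr_subr_le.
apply: (@squeeze_cvgr _ _ _ _ (fun=> 0) (fun k =>
    2 * distr (u k \- P) (u k \- P) + 2 * distr (v k \- Q) (v k \- Q))).
- by apply: nearW => k; rewrite distr_ge0 H.
- exact: cvg_cst.
- rewrite -[X in _ --> X]addr0 -{1 2}(mulr0 2).
  by apply: cvgD; apply: cvgM => //; exact: cvg_cst.
Qed.

Lemma L2cvgZ c (u : nat -> R -> R) P : (forall k, L2 (u k)) -> L2 P ->
  L2cvg u P -> L2cvg (fun k x => c * u k x) (fun x => c * P x).
Proof.
move=> Lu LP /(L2cvgE Lu LP) uP.
apply/L2cvgE; [by move=> k; exact: L2Z|exact: L2Z|].
have -> : (fun k => distr ((fun x => c * u k x) \- (fun x => c * P x))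
      ((fun x => c * u k x) \- (fun x => c * P x))) =
    (fun k => c ^+ 2 * distr (u k \- P) (u k \- P)).
  apply/funext => k.
  have -> : (fun x => c * u k x) \- (fun x => c * P x) =
      (fun x => c * (u k \- P) x) by apply/funext => x /=; rewrite mulrBr.
  have LuP : L2 (u k \- P) by exact: L2B.
  by rewrite distrZl ?distrZr ?mulrA//; exact: L2Z.
by rewrite -(mulr0 (c ^+ 2)); apply: cvgM => //; exact: cvg_cst.
Qed.

Lemma H10_L2 P : H10 P -> L2 P. Proof. by case. Qed.

Lemma H10B P Q : H10 P -> H10 Q -> H10 (P \- Q).
Proof.
move=> [LP [g Lg [u [tu uP ug]]]] [LQ [h Lh [v [tv vQ vh]]]].
split; first exact: L2B.
exists (g \- h); first exact: L2B.
exists (fun k => u k \- v k); split.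
- by move=> k; exact: test_functionB.
- by apply: L2cvgB => // k; exact: test_L2.
- have -> : (fun k => derive1 (u k \- v k)) =
      (fun k => derive1 (u k) \- derive1 (v k)).
    by apply/funext => k; rewrite derive1_testB.
  by apply: L2cvgB => // k; exact: test_L2_1.
Qed.

(** The derivative of x phi^2 has integral 0 over (0, pi), and pointwise it is at least phi^2 / 2 -
    2 pi^2 phi'^2. The constant is not sharp; the argument needs only some constant. *)
Lemma poincare phi : test_function phi ->
  distr phi phi <= 4 * pi ^+ 2 * distr (derive1 phi) (derive1 phi).
Proof.
move=> t.
have LL := L2_integrableM (test_L2 t) (test_L2 t).
have LL1 := L2_integrableM (test_L2_1 t) (test_L2_1 t).
pose F x := x * (phi x * phi x).
pose f x := 1 * (phi x * phi x) +
  x * (derive1 phi x * phi x + phi x * derive1 phi x).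
have dF x : is_derive x 1 F (f x).
  have d := test_is_derive x t.
  exact: (is_derive1M (is_derive1_id x) (is_derive1M d d)).
have cp := test_continuous t; have cp1 := test_continuous1 t.
have cf : continuous f.
  apply: continuous1D.
    by apply: continuous1M; [move=> x; exact: cst_continuous|exact: continuous1M].
  apply: continuous1M; first exact: (is_derive_continuous (@is_derive1_id R)).
  by apply: continuous1D; exact: continuous1M.
have := integral_D_derive dF cf.
rewrite /F (test_atpi t) (test_at0 t) !mulr0 subrr => f0.
have if1 : mu.-integrable D (EFin \o f).
  have := L2_integrableM (L2_continuous cf) (L2_continuous (@cst_continuous R R 1)).
  by apply: eq_integrable => // x _; rewrite /= mulr1.
have iA : mu.-integrable D (EFin \o (fun x => 2^-1 * (phi x * phi x))).
  have := integrableZl (mu := mu) measurable_D 2^-1 LL.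
  by apply: eq_integrable.
have iB : mu.-integrable D
    (EFin \o (fun x => (2 * pi ^+ 2) * (derive1 phi x * derive1 phi x))).
  have := integrableZl (mu := mu) measurable_D (2 * pi ^+ 2) LL1.
  by apply: eq_integrable.
have : \int[mu]_(x in D) (2^-1 * (phi x * phi x) -
    (2 * pi ^+ 2) * (derive1 phi x * derive1 phi x)) <= \int[mu]_(x in D) f x.
  apply: le_Rintegral => //.
    by have := integrableB (mu := mu) measurable_D iA iB; apply: eq_integrable.
  move=> x /=; rewrite in_itv /= => /andP[x0 xpi].
  rewrite /f; set a := phi x; set b := derive1 phi x.
  (* Half of this square gives a^2 + 2 x a b >= a^2 / 2 - 2 x^2 b^2; then x is replaced by its bound
     pi. *)
  have H1 : 0 <= (a + 2 * x * b) ^+ 2 by exact: sqr_ge0.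
  have H2 : 0 <= (pi ^+ 2 - x ^+ 2) * b ^+ 2.
    by rewrite mulr_ge0 ?sqr_ge0// subr_ge0 ler_sqr ?nnegrE ?pi_ge0 ?ltW.
  nra.
rewrite f0 RintegralB// RintegralZl// RintegralZl//.
rewrite -/(distr phi phi) -/(distr (derive1 phi) (derive1 phi)); lra.
Qed.

(** Integration by parts holds for each u_k, and both sides are pairings with fixed L^2 functions,
    so they converge. *)
Lemma weak_derivative P g (u : nat -> R -> R) psi : L2 P -> L2 g ->
  (forall k, test_function (u k)) -> L2cvg u P ->
  L2cvg (fun k => derive1 (u k)) g -> test_function psi ->
  distr'' P psi = - distr g (derive1 psi).
Proof.
move=> LP Lg tu uP ug tpsi.
have L1 := test_L2_1 tpsi; have L2' := test_L2_2 tpsi.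
have c1 := L2cvg_distr (fun k => test_L2 (tu k)) LP L2' uP.
have c2 := L2cvg_distr (fun k => test_L2_1 (tu k)) Lg L1 ug.
apply: (cvg_unique _ c1) => //.
have -> : (fun k => distr (u k) (derive1n 2 psi)) =
    (fun k => - distr (derive1 (u k)) (derive1 psi)).
  apply/funext => k; apply: distr_by_parts.
  - by move=> x; exact: test_is_derive.
  - by move=> x; exact: test_is_derive2.
  - exact: test_continuous1.
  - exact: test_continuous2.
  - by rewrite (test_at0 (tu k)) mul0r.
  - by rewrite (test_atpi (tu k)) mul0r.
exact: cvgN.
Qed.

End test_functions.

(** * Uniqueness and the sine modes *)

Section coth.
Set Implicit Arguments.
Unset Strict Implicit.
Context {R : realType}.
Implicit Types x y : R.

(** In this form both coth > 1 and the strict decrease can be read off. *)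
Lemma cothE x : 0 < x -> coth x = 1 + 2 / (expR (2 * x) - 1).
Proof.
move=> x0.
have E0 := expR_gt0 x.
have H : 0 < expR (2 * x) - 1 by rewrite subr_gt0 expR_gt1; lra.
have E2 : expR (2 * x) = expR x ^+ 2 by rewrite mulrC -expRM_natr.
rewrite /coth expRN E2.
have H1 : expR x ^+ 2 - 1 != 0 by rewrite -E2 gt_eqF.
field; rewrite H1 gt_eqF//=.
Qed.

Lemma coth_gt1 x : 0 < x -> 1 < coth x.
Proof.
move=> x0; rewrite cothE// ltrDl divr_gt0// subr_gt0 expR_gt1; lra.
Qed.

Lemma ltr_coth x y : 0 < x -> x < y -> coth y < coth x.
Proof.
move=> x0 xy; rewrite !cothE//; last exact: lt_trans xy.
rewrite ltrD2l ltr_pM2l// ltf_pV2.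
- by rewrite ltrD2r ltr_expR; lra.
- by rewrite posrE subr_gt0 expR_gt1; lra.
- by rewrite posrE subr_gt0 expR_gt1; lra.
Qed.

End coth.

(** * Uniqueness by the energy method *)

Section uniqueness.
Set Implicit Arguments.
Unset Strict Implicit.
Context {R : realType}.
Implicit Types (f g h phi psi P Q W S : R -> R) (x a : R).

Local Notation mu := (@lebesgue_measure R).
Local Notation D := (`]0%R, pi[%classic : set R).

Lemma sinZ_L2 (c : R) : L2 (fun x => sin (c * x)).
Proof.
by apply: L2_continuous; apply: is_derive_continuous => x; exact: is_derive_sinZ.
Qed.

Lemma sine_coefB P Q n : L2 P -> L2 Q ->
  sine_coef (P \- Q) n = sine_coef P n - sine_coef Q n.
Proof.
by move=> LP LQ; rewrite /sine_coef -mulrBr; congr (_ * _);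
   exact: (distrBl LP LQ (sinZ_L2 n%:R)).
Qed.

Lemma porous_sumB a P Q N : L2 P -> L2 Q ->
  porous_sum a (P \- Q) N = porous_sum a P N \- porous_sum a Q N.
Proof.
move=> LP LQ; apply/funext => x; rewrite /porous_sum /= -sumrB.
by apply: eq_bigr => n _; rewrite sine_coefB//; ring.
Qed.

(** Written as a difference to match [L2B] and [distrBl]. *)
Lemma porous_sumS a P N : porous_sum a P N.+1 = (fun x => porous_sum a P N x -
  (- (N.+1%:R * coth (N.+1%:R * a) * sine_coef P N.+1)) * sin (N.+1%:R * x)).
Proof.
by apply/funext => x; rewrite /porous_sum big_nat_recr//= mulNr opprK.
Qed.

Lemma porous_sum_L2 a P N : L2 (porous_sum a P N).
Proof.
elim: N => [|N IH].
  have -> : porous_sum a P 0 = (fun x => 0 * sin (0 * x)).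
    by apply/funext => x; rewrite /porous_sum big_nil mul0r.
  exact/L2Z/sinZ_L2.
by rewrite porous_sumS; apply: L2B IH _; exact/L2Z/sinZ_L2.
Qed.

(** Since [sine_coef] is 2/pi times the pairing of P with sin(nx), the n-th term contributes n
    coth(na) (2/pi) times the square of that pairing. *)
Lemma porous_sum_distr_ge0 a P N : 0 < a -> L2 P ->
  0 <= distr (porous_sum a P N) P.
Proof.
move=> a0 LP; elim: N => [|N IH].
  have -> : porous_sum a P 0 = (fun x => 0 * P x).
    by apply/funext => x; rewrite /porous_sum big_nil mul0r.
  by rewrite distrZl// mul0r.
rewrite porous_sumS distrBl//; last 2 first.
- exact: porous_sum_L2.
- exact/L2Z/sinZ_L2.
rewrite distrZl//; last exact: sinZ_L2.
rewrite mulNr opprK addr_ge0// /sine_coef.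
rewrite -/(distr P (fun x => sin (N.+1%:R * x))) distr_sym.
set s := distr _ _.
have -> : forall b c : R, b * c * (2 / pi * s) * s = b * c * (2 / pi) * s ^+ 2.
  by move=> b c; ring.
rewrite mulr_ge0 ?sqr_ge0// mulr_ge0 ?divr_ge0 ?pi_ge0// mulr_ge0 ?ler0n//.
by apply/ltW/(lt_trans ltr01)/coth_gt1; rewrite mulr_gt0// ltr0n.
Qed.

Lemma L2cvg_distr_diag (u : nat -> R -> R) v : (forall k, L2 (u k)) -> L2 v ->
  L2cvg u v -> distr (u k) (u k) @[k --> \oo] --> distr v v.
Proof.
move=> Lu Lv uv.
have c1 := L2cvg_distr Lu Lv Lv uv.
move/(L2cvgE Lu Lv): uv => c2.
(* Expanding |u_k - v|^2 leaves one term that tends to 0 and one that is linear in u_k. *)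
have -> : (fun k => distr (u k) (u k)) = (fun k =>
    distr (u k \- v) (u k \- v) + (2 * distr (u k) v - distr v v)).
  apply/funext => k; rewrite distrBl ?distrBr//; last exact: L2B.
  rewrite [distr v (u k)]distr_sym; ring.
rewrite [X in _ --> X](_ : _ = 0 + (2 * distr v v - distr v v)); last by ring.
apply: cvgD => //; apply: cvgB; last exact: cvg_cst.
by apply: cvgM => //; exact: cvg_cst.
Qed.

(* Testing the homogeneous equation with W itself: both |W'|^2 and
   sum_n (pi/2) n coth(na) b_n^2 are nonnegative, hence vanish. *)
Lemma homogeneous_porous_eq0 a W S : 0 < a -> H10 W -> L2 S ->
  L2cvg (porous_sum a W) S ->
  (forall phi, test_function phi -> - distr'' W phi + distr S phi = 0) ->
  distr W W = 0.
Proof.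
move=> a0 [LW [g Lg [u [tu uW ug]]]] LS WS eqW.
have Lu k : L2 (u k) by exact: test_L2.
have Lu1 k : L2 (derive1 (u k)) by exact: test_L2_1.
(* The equation tested with u_k, with one derivative moved from u_k'' onto W; the limit in k then
   amounts to testing with W. *)
have e k : distr (derive1 (u k)) g + distr (u k) S = 0.
  have := eqW _ (tu k); rewrite (weak_derivative LW Lg tu uW ug (tu k)) opprK.
  by rewrite [distr g _]distr_sym [distr S _]distr_sym.
have c1 := L2cvg_distr Lu1 Lg Lg ug.
have c2 := L2cvg_distr Lu LW LS uW.
have gS : distr g g + distr W S = 0.
  have c : distr (derive1 (u k)) g + distr (u k) S @[k --> \oo]
      --> distr g g + distr W S by exact: cvgD.
  rewrite (_ : (fun k => _) = cst 0) in c; last by apply/funext => k; exact: e.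
  by apply: (cvg_unique _ c) => //; exact: cvg_cst.
have c3 := L2cvg_distr (porous_sum_L2 a W) LS LW WS.
have SW0 : 0 <= distr S W.
  rewrite -(cvg_lim _ c3)//; apply: limr_ge; first by apply/cvg_ex; exists (distr S W).
  by apply: nearW => N; exact: porous_sum_distr_ge0.
have g0 : distr g g = 0.
  have := distr_ge0 g; rewrite distr_sym in SW0; lra.
have c4 := L2cvg_distr_diag Lu1 Lg ug; rewrite g0 in c4.
have c5 := L2cvg_distr_diag Lu LW uW.
(* |W|^2 is the limit of |u_k|^2, which Poincare bounds by a multiple of |u_k'|^2, and this tends to
   |g|^2 = 0. *)
apply: (cvg_unique _ c5) => //.
apply: (@squeeze_cvgr _ _ _ _ (fun=> 0)
    (fun k => 4 * pi ^+ 2 * distr (derive1 (u k)) (derive1 (u k)))).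
- by apply: nearW => k; rewrite distr_ge0 poincare.
- exact: cvg_cst.
- by rewrite -(mulr0 (4 * pi ^+ 2)); apply: cvgM => //; exact: cvg_cst.
Qed.

Lemma porous_problem_unique a P Q : 0 < a -> porous_problem a P ->
  porous_problem a Q -> ae_eq mu D Q P.
Proof.
move=> a0 [HP [S [LS PS eP]]] [HQ [T [LT QT eQ]]].
have LP := H10_L2 HP; have LQ := H10_L2 HQ.
have := @homogeneous_porous_eq0 a (Q \- P) (T \- S) a0 (H10B HQ HP) (L2B LT LS).
have H1 : L2cvg (porous_sum a (Q \- P)) (T \- S).
  have -> : porous_sum a (Q \- P) =
      (fun N => porous_sum a Q N \- porous_sum a P N).
    by apply/funext => N; exact: porous_sumB.
  by apply: L2cvgB => //; exact: porous_sum_L2.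
have H2 phi : test_function phi ->
    - distr'' (Q \- P) phi + distr (T \- S) phi = 0.
  move=> t; have L2'' := test_L2_2 t; have L0 := test_L2 t.
  rewrite /distr'' !distrBl//.
  have := eP _ t; have := eQ _ t; rewrite /distr''; lra.
move=> /(_ H1 H2)/(distr_eq0_ae (L2B LQ LP)).
by apply: filterS => x /= H Dx; apply/eqP; rewrite -subr_eq0; apply/eqP; exact: H.
Qed.

End uniqueness.

(** * The operators acting on the mode sin(2x) *)

Section existence.
Set Implicit Arguments.
Unset Strict Implicit.
Context {R : realType}.
Implicit Types (x a c : R) (n : nat) (phi : R -> R).

Local Notation mu := (@lebesgue_measure R).
Local Notation D := (`]0%R, pi[%classic : set R).

Lemma sin_natpi n : sin (n%:R * pi) = 0 :> R.
Proof.
elim: n => [|n IH]; first by rewrite mul0r sin0.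
by rewrite -natr1 mulrDl mul1r sinDpi IH oppr0.
Qed.

Lemma sin_2pi : sin (2 * pi) = 0 :> R.
Proof. exact: (sin_natpi 2). Qed.

Lemma sinZ_continuous c : continuous (fun x => sin (c * x)).
Proof. by apply: is_derive_continuous => x; exact: is_derive_sinZ. Qed.

Lemma distr_sin2_sin n : distr (fun x : R => sin (2 * x)) (fun x => sin (n%:R * x))
  = if n == 2 then pi / 2 else 0.
Proof.
have s (c x : R) := is_derive_sinZ c x.
have C (c x : R) := is_derive_cosZ c x.
case: eqP => [->|n2].
  have dF x : is_derive x 1
      (fun x : R => 2^-1 * x - 4^-1 * (sin (2 * x) * cos (2 * x)))
      (sin (2 * x) * sin (2 * x)).
    have := is_derive1B (is_derive1Z 2^-1 (is_derive1_id x))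
      (is_derive1Z 4^-1 (is_derive1M (s 2 x) (C 2 x))).
    by move/is_derive_eq; apply; have := cos2Dsin2 (2 * x); nra.
  have cf : continuous (fun x : R => sin (2 * x) * sin (2 * x)).
    by apply: continuous1M; exact: sinZ_continuous.
  rewrite /distr (integral_D_derive dF cf) sin_2pi !mulr0 sin0 !mul0r.
  by rewrite !mulr0 !subr0 mulrC.
set m : R := n%:R.
have m2 : m ^+ 2 - 4 != 0.
  have -> : m ^+ 2 - 4 = (m - 2) * (m + 2) by ring.
  rewrite mulf_neq0// ?subr_eq0 /m ?eqr_nat; first exact/eqP.
  by rewrite gt_eqF// -natrD ltr0n addn2.
(* The antiderivative is the Wronskian of sin(2x) and sin(mx) divided by m^2 - 4; it vanishes at
   both ends because both sines do. *)
have dF x : is_derive x 1 (fun x : R => (m ^+ 2 - 4)^-1 *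
     (2 * (cos (2 * x) * sin (m * x)) - m * (sin (2 * x) * cos (m * x))))
     (sin (2 * x) * sin (m * x)).
  have := is_derive1Z (m ^+ 2 - 4)^-1
    (is_derive1B (is_derive1Z 2 (is_derive1M (C 2 x) (s m x)))
                 (is_derive1Z m (is_derive1M (s 2 x) (C m x)))).
  by move/is_derive_eq; apply; field.
have cf : continuous (fun x : R => sin (2 * x) * sin (m * x)).
  by apply: continuous1M; exact: sinZ_continuous.
rewrite /distr (integral_D_derive dF cf) sin_2pi sin_natpi !mulr0 sin0.
by rewrite !(mulr0, mul0r, subr0).
Qed.

Lemma sine_coef_sin2 c n :
  sine_coef (fun x => c * sin (2 * x)) n = if n == 2 then c else 0.
Proof.
rewrite /sine_coef -/(distr (fun x => c * sin (2 * x)) (fun x => sin (n%:R * x))).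
rewrite distrZl; [|exact: sinZ_L2|exact: sinZ_L2].
rewrite distr_sin2_sin; case: eqP => _; last by rewrite !mulr0.
have pi0 : pi != 0 :> R by rewrite gt_eqF ?pi_gt0.
by rewrite mulrCA mulf_div [2 * _]mulrC divff ?mulr1// mulf_neq0.
Qed.

(** The partial sums are stationary once the index 2 is included, so their L^2 convergence is
    eventual equality. *)
Lemma porous_sum_sin2 a c N : (1 < N)%N ->
  porous_sum a (fun x => c * sin (2 * x)) N =
  (fun x => (2 * coth (2 * a) * c) * sin (2 * x)).
Proof.
move=> N1; apply/funext => x; rewrite /porous_sum.
rewrite (bigD1_seq 2)/= ?iota_uniq//; last by rewrite mem_index_iota.
rewrite sine_coef_sin2 eqxx big1_seq ?addr0// => n /andP[/negbTE n2 _].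
by rewrite sine_coef_sin2 n2 mulr0 mul0r.
Qed.

Lemma distr''_sin2 c phi : test_function phi ->
  distr'' (fun x => c * sin (2 * x)) phi =
  - (4 * c) * distr (fun x => sin (2 * x)) phi.
Proof.
move=> t.
have d1 x : is_derive x 1 (fun x => c * sin (2 * x)) (c * (2 * cos (2 * x))).
  exact/is_derive1Z/is_derive_sinZ.
have d2 x : is_derive x 1 (fun x => c * (2 * cos (2 * x)))
    (- (4 * c) * sin (2 * x)).
  have := is_derive1Z c (is_derive1Z 2 (is_derive_cosZ 2 x)).
  by move/is_derive_eq; apply; ring.
have c1 := is_derive_continuous d2.
have c2 : continuous (fun x => - (4 * c) * sin (2 * x)).
  by apply: continuous1M; [move=> x; exact: cst_continuous|exact: sinZ_continuous].
have t1 x := test_is_derive x t; have t2 x := test_is_derive2 x t.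
rewrite /distr'' (distr_by_parts d1 t2 c1 (test_continuous2 t)); last 2 first.
- by rewrite mulr0 sin0 mulr0 mul0r.
- by rewrite sin_2pi mulr0 mul0r.
rewrite (distr_by_parts d2 t1 c2 (test_continuous1 t)); last 2 first.
- by rewrite (test_at0 t) mulr0.
- by rewrite (test_atpi t) mulr0.
by rewrite opprK distrZl//; [exact: sinZ_L2|exact: test_L2].
Qed.

End existence.

(** * Membership of sin(2x) in H^1_0(0, pi) *)

Section sine_in_H10.
Set Implicit Arguments.
Unset Strict Implicit.
Context {R : realType}.
Implicit Types (f g h phi psi P Q W S : R -> R) (x a c t : R) (k : nat).

Local Notation mu := (@lebesgue_measure R).
Local Notation D := (`]0%R, pi[%classic : set R).

(** Dominated convergence for (u_k - v)^2, with the constant majorant M^2 on an interval of finite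
    measure. *)
Lemma L2cvg_dominated (u : nat -> R -> R) (v : R -> R) (M : R) :
  (forall k, continuous (u k)) -> continuous v ->
  (forall k x, D x -> `|u k x - v x| <= M) ->
  (forall x, D x -> u k x @[k --> \oo] --> v x) -> L2cvg u v.
Proof.
move=> cu cv bM uv.
have Lu k : L2 (u k) by exact: L2_continuous.
have Lv : L2 v by exact: L2_continuous.
apply/(L2cvgE Lu Lv).
pose f k x := ((u k \- v) x * (u k \- v) x)%:E.
have if_ k : mu.-integrable D (f k).
  by apply: L2_integrableM; exact: L2B.
have [|||||_ _ H] := @dominated_convergence _ _ _ mu D measurable_D f
    (cst 0%E) (cst (M ^+ 2)%:E).
- by move=> k; case/integrableP: (if_ k).
- exact: measurable_cst.
- apply: aeW => x Dx; apply: cvg_EFin; first exact: nearW.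
  rewrite -(mulr0 0) -(subrr (v x)).
  by apply: cvgM; apply: cvgB; (exact: uv || exact: cvg_cst).
- have LM : L2 (fun _ : R => M) by apply: L2_continuous => x; exact: cst_continuous.
  have := L2_integrableM LM LM; apply: eq_integrable => //.
- apply: aeW => x k Dx; rewrite lee_fin normrM -expr2 ler_sqr ?nnegrE//.
    exact: bM.
  exact: le_trans (bM k x Dx).
rewrite integral0 in H; exact: (fine_cvg H).
Qed.

Lemma sin_le_id x : 0 <= x -> sin x <= x.
Proof.
rewrite le_eqVlt => /predU1P[<-|x0]; first by rewrite sin0.
have [|c _] := MVT x0 (fun y _ => is_derive_sin y).
  exact/continuous_subspaceT/continuous_sin.
rewrite sin0 !subr0 => ->.
by rewrite ger_pMl// cos_le1.
Qed.

Lemma normr_sin2_le x : D x -> `|sin (2 * x)| <= 2 * (x * (pi - x)).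
Proof.
rewrite /= in_itv /= => /andP[x0 xpi].
have sx : 0 <= sin x by rewrite sin_ge0_pi// !ltW.
have s1 : sin x <= x by rewrite sin_le_id// ltW.
have s2 : sin x <= pi - x.
  have <- : sin (pi - x) = sin x by rewrite sinB sinpi cospi mul0r; ring.
  by rewrite sin_le_id// subr_ge0 ltW.
have sq : sin x <= x * (pi - x).
  (* One of x and pi - x is at least pi/2 >= 1, so the other one is at most their product. *)
  have := pi_ge2 R; have [xl|xl] := leP x (pi / 2); nra.
rewrite mulr2n mulrDl !mul1r -mulr2n sin_mulr2n.
rewrite normrMn normrM (ger0_norm sx) -mulr_natl ler_pM2l//.
by rewrite (le_trans _ sq)// ler_piMl// cos_max.
Qed.

Lemma flat0_ge t : 0 < t -> 1 - t^-1 <= flat 0 t.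
Proof. by move=> t0; rewrite /flat t0 expr0 mulr1 expR_ge1Dx. Qed.

Lemma flatS_le m t : 0 < t -> flat m.+1 t <= m`!%:R * t^-1.
Proof. by move=> t0; rewrite ler_pdivlMr// mulrC flatS flat_le_fact. Qed.

(** Subtractions are spelled with -1 to fit the constructors of [elementary]. The final -1 keeps the
    set where the value is nonnegative away from 0 and pi. *)
Definition bump_arg k x : R := k.+1%:R * (x * (pi + -1 * x)) + -1.

Lemma bump_argE k x : bump_arg k x = k.+1%:R * (x * (pi - x)) - 1.
Proof. by rewrite /bump_arg mulN1r. Qed.

Lemma bump_arg_inv_cvg x : D x -> (bump_arg k x)^-1 @[k --> \oo] --> 0.
Proof.
rewrite /= in_itv /= => /andP[x0 xpi].
have q0 : 0 < x * (pi - x) by rewrite mulr_gt0// subr_gt0.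
apply/cvgrPdist_le => /= e e0.
have := nbhs_infty_ger ((e^-1 + 1) / (x * (pi - x))).
apply: filterS => k; rewrite ler_pdivrMr// => H.
have ei : 0 < e^-1 by rewrite invr_gt0.
have Hk : e^-1 <= bump_arg k x.
  rewrite bump_argE -natr1; nra.
have t0 := lt_le_trans ei Hk.
by rewrite sub0r normrN gtr0_norm ?invr_gt0// -[leRHS]invrK lef_pV2.
Qed.

Lemma bump_arg_gt0 x : D x -> \forall k \near \oo, 0 < bump_arg k x.
Proof.
rewrite /= in_itv /= => /andP[x0 xpi].
have q0 : 0 < x * (pi - x) by rewrite mulr_gt0// subr_gt0.
have := nbhs_infty_ger ((1 + 1) / (x * (pi - x))).
apply: filterS => k; rewrite ler_pdivrMr// => H.
by rewrite bump_argE -natr1; nra.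
Qed.

Lemma flat0_cvg x : D x -> flat 0 (bump_arg k x) @[k --> \oo] --> (1 : R).
Proof.
move=> Dx; apply: (@squeeze_cvgr _ _ _ _ (fun k => 1 - (bump_arg k x)^-1) (fun=> 1)).
- apply: filterS (bump_arg_gt0 Dx) => k t0.
  by rewrite flat0_ge//= (le_trans (flat_le_fact _ _)).
- rewrite -[X in _ --> X]subr0; apply: cvgB; first exact: cvg_cst.
  exact: bump_arg_inv_cvg.
- exact: cvg_cst.
Qed.

Lemma flatS_cvg m x : D x -> flat m.+1 (bump_arg k x) @[k --> \oo] --> (0 : R).
Proof.
move=> Dx; apply: (@squeeze_cvgr _ _ _ _ (fun=> 0) (fun k => m`!%:R * (bump_arg k x)^-1)).
- apply: filterS (bump_arg_gt0 Dx) => k t0.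
  by rewrite flat_ge0 flatS_le.
- exact: cvg_cst.
- rewrite -(mulr0 m`!%:R); apply: cvgM; first exact: cvg_cst.
  exact: bump_arg_inv_cvg.
Qed.

Definition cutoff_sin k x : R := sin (2 * x) * flat 0 (bump_arg k x).

(** The summand with [flat 2], the derivative of [flat 0], is the error caused by the cutoff. *)
Definition cutoff_sin' k x : R := 2 * cos (2 * x) * flat 0 (bump_arg k x) +
  sin (2 * x) * (flat 2 (bump_arg k x) * (k.+1%:R * (pi - 2 * x))).

Lemma is_derive_cutoff_sin k x :
  is_derive x 1 (cutoff_sin k) (cutoff_sin' k x).
Proof.
have db : is_derive x 1 (bump_arg k) (k.+1%:R * (pi - 2 * x)).
  have := is_derive1D (is_derive1Z k.+1%:R (is_derive1M (is_derive1_id x)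
    (is_derive1D (is_derive1_cst pi x) (is_derive1Z (-1) (is_derive1_id x)))))
    (is_derive1_cst (-1) x).
  by move/is_derive_eq; apply; ring.
have dfb := is_derive1_comp (is_derive_flat 0 (bump_arg k x)) db.
have := is_derive1M (is_derive_sinZ 2 x) dfb.
by move/is_derive_eq; apply; rewrite mul0r subr0.
Qed.

Lemma elementary_bump_arg k : elementary (bump_arg k).
Proof.
apply: elementaryD; last exact: elementary_cst.
apply: elementaryM; first exact: elementary_cst.
apply: elementaryM; first exact: elementary_id.
apply: elementaryD; first exact: elementary_cst.
by apply: elementaryM; [exact: elementary_cst|exact: elementary_id].
Qed.

Lemma test_cutoff_sin c k : test_function (fun x => c * cutoff_sin k x).
Proof.
split.
  apply: elementary_smooth; apply: elementaryM; first exact: elementary_cst.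
  apply: elementaryM.
    apply: (@elementary_comp _ sin (fun x => 2 * x)); first exact: elementary_sin.
    by apply: elementaryM; [exact: elementary_cst|exact: elementary_id].
  apply: (@elementary_comp _ (flat 0) (bump_arg k)); first exact: elementary_flat.
  exact: elementary_bump_arg.
have [b _ db] := elementary_derive (elementary_bump_arg k).
have cb := is_derive_continuous db.
(* At 0 and pi the value of [bump_arg] is -1, so this compact set lies in the open interval.
   Conversely, a positive value forces x (pi - x) > 0, hence x in (0, pi). *)
exists (`[0, pi]%classic `&` (bump_arg k @^-1` [set y | 0 <= y])); split.
- apply: (@subclosed_compact _ _ `[0, pi]%classic).
  + apply: closedI; first exact: interval_closed.
    by apply: preimage_closed; [move=> x _; exact: cb|exact: closed_ge].
  + exact: segment_compact.
  + exact: subIsetl.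
- move=> x [/=]; rewrite !in_itv /= => /andP[x0 xpi] tx.
  rewrite !lt_neqAle x0 xpi !andbT; apply/andP; split; apply/eqP => E;
    move: tx; rewrite bump_argE -?E; nra.
- move=> x Kx; rewrite /cutoff_sin flat_le0 ?mulr0// leNgt; apply/negP => t0.
  apply: Kx; split; last exact: ltW.
  rewrite /= in_itv /=; move: t0; rewrite bump_argE => t0.
  have k0 : 0 < k.+1%:R :> R by rewrite ltr0n.
  have q0 : 0 < x * (pi - x).
    by rewrite -(pmulr_rgt0 _ k0); lra.
  have p0 := pi_gt0 R.
  by apply/andP; split; rewrite leNgt; apply/negP => ?; nra.
Qed.

(** With t the value of [bump_arg], the bound on |sin(2x)| and |pi - 2x| <= pi leave 2 pi (t + 1)
    [flat 2 t], and t [flat 2 t] = [flat 1 t]. *)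
Lemma cutoff_error_le k x : D x ->
  `|sin (2 * x) * (flat 2 (bump_arg k x) * (k.+1%:R * (pi - 2 * x)))|
  <= 2 * pi * (flat 1 (bump_arg k x) + flat 2 (bump_arg k x)).
Proof.
move=> Dx; have s := normr_sin2_le Dx.
move: (Dx); rewrite /= in_itv /= => /andP[x0 xpi].
have q0 : 0 < x * (pi - x) by rewrite mulr_gt0// subr_gt0.
have fS := flatS 1 (bump_arg k x).
have f2 := flat_ge0 2 (bump_arg k x).
have k0 : 0 <= k.+1%:R :> R by [].
have px : `|pi - 2 * x| <= pi by rewrite ler_norml; apply/andP; split; lra.
rewrite !normrM (ger0_norm f2) (ger0_norm k0).
have -> : 2 * pi * (flat 1 (bump_arg k x) + flat 2 (bump_arg k x)) =
    2 * (x * (pi - x)) * (flat 2 (bump_arg k x) * (k.+1%:R * pi)).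
  by rewrite -fS {1}bump_argE; ring.
apply: ler_pM => //; first by rewrite !mulr_ge0.
by rewrite ler_wpM2l// ler_wpM2l.
Qed.

Lemma H10_sin2 c : H10 (fun x => c * sin (2 * x)).
Proof.
have cs : continuous (fun x : R => sin (2 * x)).
  by apply: is_derive_continuous => x; exact: is_derive_sinZ.
have cc : continuous (fun x : R => 2 * cos (2 * x)).
  apply: continuous1M; first by move=> x; exact: cst_continuous.
  by apply: is_derive_continuous => x; exact: is_derive_cosZ.
have c0 k : continuous (cutoff_sin k).
  by apply: is_derive_continuous => x; exact: is_derive_cutoff_sin.
have c1 k : continuous (cutoff_sin' k).
  have [b _ db] := elementary_derive (elementary_bump_arg k).
  have cb := is_derive_continuous db.
  have cf m : continuous (fun x => flat m (bump_arg k x)).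
    have cfl := is_derive_continuous (@is_derive_flat R m).
    by move=> x; apply: (@continuous_comp _ _ _ (bump_arg k) (flat m)); [exact: cb|exact: cfl].
  apply: continuous1D; first exact: continuous1M.
  apply: continuous1M => //; apply: continuous1M => //.
  have d x := is_derive1Z k.+1%:R
    (is_derive1B (is_derive1_cst pi x) (is_derive1Z 2 (is_derive1_id x))).
  exact: (is_derive_continuous d).
have f01 k x : `|flat 0 (bump_arg k x) - 1| <= 1.
  have := flat_ge0 0 (bump_arg k x); have := flat_le_fact 0 (bump_arg k x).
  by rewrite fact0 => ? ?; rewrite ler_norml; apply/andP; split; lra.
have cvg0 : L2cvg cutoff_sin (fun x => sin (2 * x)).
  apply: (@L2cvg_dominated _ _ 1) => // [k x Dx|x Dx].
    rewrite /cutoff_sin -[X in _ - X]mulr1 -mulrBr normrM -[leRHS]mulr1.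
    by apply: ler_pM => //; exact: sin_max.
  rewrite -[X in _ --> X]mulr1; apply: cvgM; first exact: cvg_cst.
  exact: flat0_cvg.
have cvg1 : L2cvg cutoff_sin' (fun x => 2 * cos (2 * x)).
  (* The 2 bounds 2 cos(2x) ([flat 0] - 1); the 6 pi is 2 pi (1! + 2!), from the factorial bounds on
     [flat 1] and [flat 2]. *)
  apply: (@L2cvg_dominated _ _ (2 + 6 * pi)) => // [k x Dx|x Dx].
    rewrite /cutoff_sin' addrAC -[X in _ - X + _]mulr1 -mulrBr.
    apply: le_trans (ler_normD _ _) _; apply: lerD.
      rewrite normrM -[leRHS]mulr1; apply: ler_pM => //.
      by rewrite normrM ger0_norm// ler_piMr// cos_max.
    apply: le_trans (cutoff_error_le k Dx) _.
    have := flat_le_fact 1 (bump_arg k x); have := flat_le_fact 2 (bump_arg k x).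
    by have := pi_gt0 R; rewrite !factS fact0 !mul1n !muln1; nra.
  rewrite -[X in _ --> X]addr0; apply: cvgD.
    rewrite -[X in _ --> X]mulr1; apply: cvgM; first exact: cvg_cst.
    exact: flat0_cvg.
  have B0 : 2 * pi * (flat 1 (bump_arg k x) + flat 2 (bump_arg k x))
      @[k --> \oo] --> 0.
    rewrite -(mulr0 (2 * pi)); apply: cvgM; first exact: cvg_cst.
    by rewrite -[X in _ --> X]addr0; apply: cvgD; exact: flatS_cvg.
  apply: (@squeeze_cvgr _ _ _ _
    (fun k => - (2 * pi * (flat 1 (bump_arg k x) + flat 2 (bump_arg k x))))
    (fun k => 2 * pi * (flat 1 (bump_arg k x) + flat 2 (bump_arg k x)))) => //.
    by apply: nearW => k; rewrite -ler_norml; exact: cutoff_error_le.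
  by rewrite -[X in _ --> X]oppr0; exact: cvgN.
have Ls := L2_continuous cs; have Lc := L2_continuous cc.
split; first exact: L2Z.
exists (fun x => c * (2 * cos (2 * x))); first exact: L2Z.
exists (fun k x => c * cutoff_sin k x); split.
- by move=> k; exact: test_cutoff_sin.
- by apply: L2cvgZ => // k; exact: L2_continuous.
- have -> : (fun k => derive1 (fun x => c * cutoff_sin k x)) =
      (fun k x => c * cutoff_sin' k x).
    apply/funext => k; apply: is_derive_derive1 => x.
    exact/is_derive1Z/is_derive_cutoff_sin.
  by apply: L2cvgZ => // k; exact: L2_continuous.
Qed.

End sine_in_H10.

(** * The explicit solutions *)

Section solutions.
Set Implicit Arguments.
Unset Strict Implicit.
Context {R : realType}.
Implicit Types (x a : R).

Lemma P_porousE a : P_porous a = (fun x => (2 * (2 + coth (2 * a)))^-1 * sin (2 * x)).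
Proof. by apply/funext => x; rewrite /P_porous mulrC. Qed.

Lemma coth2_gt1 a : 0 < a -> 1 < coth (2 * a).
Proof. by move=> a0; rewrite coth_gt1// mulr_gt0. Qed.

Lemma porous_problem_P_porous a : 0 < a -> porous_problem a (P_porous a).
Proof.
move=> a0; rewrite P_porousE; set c := _^-1.
split; first exact: H10_sin2.
have Ls : L2 (fun x => sin (2 * x)) by exact: sinZ_L2.
exists (fun x => (2 * coth (2 * a) * c) * sin (2 * x)); split; first exact: L2Z.
- apply/L2cvgE; [by move=> N; exact: porous_sum_L2|exact: L2Z|].
  apply: cvg_near_cst; near=> N.
  rewrite porous_sum_sin2; last by near: N; exists 2%N.
  set f := fun x : R => _.
  have Lf : L2 f by exact: L2Z.
  by rewrite distrBl ?subrr//; exact: L2B.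
- move=> phi t; rewrite distr''_sin2// distrZl//; last exact: test_L2.
  have := coth2_gt1 a0 => k1; rewrite mulNr opprK -mulrDl.
  (* On sin(2x), minus the second derivative acts as 4 and the multiplier as 2 coth(2a); c is the
     reciprocal of their sum. *)
  have -> : 4 * c + 2 * coth (2 * a) * c = 1.
    by rewrite /c; field; rewrite gt_eqF//; lra.
  by rewrite mul1r.
Unshelve. all: by end_near. Qed.

Lemma nonporous_problem_P_nonporous : nonporous_problem (@P_nonporous R).
Proof.
have -> : @P_nonporous R = (fun x => 4^-1 * sin (2 * x)).
  by apply/funext => x; rewrite /P_nonporous mulrC.
split; first exact: H10_sin2.
by move=> phi t; rewrite distr''_sin2// mulNr opprK divff ?mul1r.
Qed.

Lemma sin2_gt0 x : 0 < x < pi / 2 -> 0 < sin (2 * x).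
Proof. by move=> /andP[x0 x1]; apply: sin_gt0_pi; apply/andP; split; lra. Qed.

Lemma sin2_le0 x : pi / 2 < x <= pi -> sin (2 * x) <= 0.
Proof.
move=> /andP[x0 x1].
have -> : 2 * x = (2 * x - pi) + pi by ring.
by rewrite sinDpi oppr_le0 sin_ge0_pi//; apply/andP; split; lra.
Qed.

End solutions.

Theorem mainTheorem4 (R : realType) :
  (forall a : R, 0 < a ->
    [/\ porous_problem a (P_porous a),
        P_porous a 0 = 0, P_porous a pi = 0 &
        forall Q : R -> R, porous_problem a Q ->
          ae_eq (@lebesgue_measure R) `]0, pi[%classic Q (P_porous a)]) /\
  [/\ nonporous_problem (@P_nonporous R),
      @P_nonporous R 0 = 0 & @P_nonporous R pi = 0] /\
  (forall a : R, 0 < a ->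
    forall x : R, 0 <= x <= pi -> sin (2 * x) != 0 ->
      `|P_nonporous x| > `|P_porous a x|) /\
  (forall a : R, 0 < a ->
    [/\ forall x : R, 0 <= x <= pi / 2 ->
          (P_porous a)^\+ x = sin (2 * x) / (2 * (2 + coth (2 * a))),
        forall x : R, pi / 2 < x <= pi -> (P_porous a)^\+ x = 0 &
        forall x : R, 0 < x < pi / 2 ->
          (P_porous a)^\+ x < (@P_nonporous R)^\+ x]) /\
  (forall x : R, 0 < x < pi / 2 ->
    forall a1 a2 : R, 0 < a1 -> a1 < a2 ->
      (P_porous a1)^\+ x < (P_porous a2)^\+ x).
Proof.
have den_gt0 (a : R) : 0 < a -> 0 < 2 * (2 + coth (2 * a)).
  by move=> /coth2_gt1 ?; lra.
(* Here 4 is the denominator of [P_nonporous]: both pressures share the numerator sin(2x), so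
   comparing them means comparing denominators. *)
have den_gt4 (a : R) : 0 < a -> 4 < 2 * (2 + coth (2 * a)).
  by move=> /coth2_gt1 ?; lra.
have posE (a x : R) : 0 < a -> 0 < x < pi / 2 -> (P_porous a)^\+ x = P_porous a x.
  move=> a0 /sin2_gt0 s0; rewrite /funrpos max_l//.
  by rewrite divr_ge0// ltW// den_gt0.
split; [|split; [|split; [|split]]].
- move=> a a0; split.
  + exact: porous_problem_P_porous.
  + by rewrite /P_porous mulr0 sin0 mul0r.
  + by rewrite /P_porous sin_2pi mul0r.
  + move=> Q HQ; apply: porous_problem_unique HQ => //.
    exact: porous_problem_P_porous.
- split; first exact: nonporous_problem_P_nonporous.
  + by rewrite /P_nonporous mulr0 sin0 mul0r.
  + by rewrite /P_nonporous sin_2pi mul0r.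
- move=> a a0 x _ s0; rewrite /P_nonporous /P_porous !normrM ltr_pM2l ?normr_gt0//.
  rewrite !gtr0_norm ?invr_gt0 ?den_gt0//.
  by rewrite ltf_pV2 ?posrE ?den_gt0 ?den_gt4.
- move=> a a0; split.
  + move=> x /andP[x0 x1]; rewrite /funrpos max_l// divr_ge0//; last exact/ltW/den_gt0.
    by apply: sin_ge0_pi; apply/andP; split; lra.
  + move=> x /sin2_le0 s0; rewrite /funrpos max_r//.
    by rewrite mulr_le0_ge0// invr_ge0 ltW// den_gt0.
  + move=> x x01; rewrite posE//; have s0 := sin2_gt0 x01.
    rewrite /funrpos max_l; last by rewrite divr_ge0// ltW.
    rewrite /P_nonporous /P_porous ltr_pM2l//.
    by rewrite ltf_pV2 ?posrE ?den_gt0 ?den_gt4.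
- move=> x x01 a1 a2 a10 a12; have a20 := lt_trans a10 a12.
  rewrite !posE// /P_porous ltr_pM2l ?sin2_gt0//.
  rewrite ltf_pV2 ?posrE ?den_gt0// ltr_pM2l// ltrD2l.
  by apply: ltr_coth; [rewrite mulr_gt0|rewrite ltr_pM2l].
Qed.
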